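(* Let $c_0$ be an $\mathbb{R}$-$\mathbb{R}$ TS function which is bounded and whose first derivative satisfies $-\frac{1}{a_{c,{\rm M}}}\le c_0'(x)\le a_{c,{\rm m}}$ for every $x\in\mathbb{R}$, for some two real numbers $a_{c,{\rm m}},a_{c,{\rm M}}>0$ with $a_{c,{\rm m}}<a_{c,{\rm M}}$. Let $0<a_c<a_{c,{\rm M}}$. Assume that the level set $(c_0')^{-1}(a_c)$ is non-empty and is of the form $\bigsqcup_{j=1}^{l}I_{0,j}$ with $l$ a positive integer, $\bigsqcup_{j=1}^{\infty}I_{0,j}$, or $\bigsqcup_{j=-\infty}^{\infty}I_{0,j}$, where each $I_{0,j}$ is a closed connected non-empty set which is a one-point set or a copy of $D^1$, $\{t\ge0\}$, or $\mathbb{R}$. Assume also that the union of the tangent lines of the graph $\{(c_0(x),x)\mid x\in\mathbb{R}\}$ at all points $(c_0(x),x)$ with $x\in(c_0')^{-1}(a_c)$ is the disjoint union of at most countably many tangent lines and is also a closed set of $\mathbb{R}^2$. Then there is a rotation of $\mathbb{R}^2$ mapping the graph $\{(c_0(x),x)\mid x\in\mathbb{R}\}$ onto the graph $\{(c_1(x),x)\mid x\in\mathbb{R}\}$ of a function $c_1:\mathbb{R}\to\mathbb{R}$ such that, with $c_2:=c_1+a$ ($a>0$), the following hold. \begin{enumerate} \item $c_1$ and $c_2$ are $\mathbb{R}$-$\mathbb{R}$ TS functions with $c_1(x)<c_2(x)$ for all $x$, and $c_1(S(c_1))\cup c_2(S(c_2))$ is a discrete and closed subset of $\mathbb{R}$.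 \item The sets $S(c_1)$ and $S(c_2)$ are both non-empty. \item Both $c_1(x)$ and $c_2(x)$ diverge to $+\infty$ as $x$ diverges to $-\infty$. \item Both $c_1(x)$ and $c_2(x)$ diverge to $-\infty$ as $x$ diverges to $+\infty$. \end{enumerate}
   Context: For a differentiable function $c$, $S(c)$ denotes its set of critical points. An $\mathbb{R}$-$\mathbb{R}$ TS function is a smooth function $c:\mathbb{R}\to\mathbb{R}$ whose critical set $S(c)$ is a disjoint union of finitely many (possibly none) or countably many sets each of which is a one-point set or a copy of $D^1=[-1,1]$, $\{t\ge0\}$, or $\mathbb{R}$. The graph of a function $c:\mathbb{R}\to\mathbb{R}$ is always taken as the subset $\{(c(x),x)\mid x\in\mathbb{R}\}$ of $\mathbb{R}^2$ (value in the first coordinate). *)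

(* Defs.v *)
From HB Require Import structures.
From mathcomp Require Import all_boot all_order all_algebra.
From mathcomp Require Import all_classical all_reals all_analysis.
Set Implicit Arguments.
Unset Strict Implicit.
Unset Printing Implicit Defensive.
Import Order.TTheory GRing.Theory Num.Theory.
Import numFieldNormedType.Exports.
Local Open Scope classical_set_scope.
Local Open Scope ring_scope.

(* Disjoint union of spaces: A carries the coproduct topology of the pieces,
   i.e., each piece is open in A; a mere set-theoretic partition such as
   {0} U {1/n | n >= 1} into singletons does not qualify.  *)
Definition disjoint_union_of (T : topologicalType) (J : Type) (D : set J)
    (F : J -> set T) (A : set T) : Prop :=
  [/\ A = \bigcup_(j in D) F j,
      trivIset D F &
      forall j, D j -> exists2 U : set T, open U & F j = A `&` U].

Definition homeomorphic_sets (T U : topologicalType) (A : set T) (B : set U)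
    : Prop :=
  exists (f : T -> U) (g : U -> T),
    [/\ f @` A = B, {in A, cancel f g},
        {within A, continuous f} & {within B, continuous g}].

Definition point_or_interval (R : realType) (A : set R) : Prop :=
  [\/ exists x : R, A = [set x],
      homeomorphic_sets A `[(-1 : R), 1]%classic,
      homeomorphic_sets A `[(0 : R), +oo[%classic |
      homeomorphic_sets A [set: R]].

Definition smooth (R : realType) (c : R -> R) : Prop :=
  forall (n : nat) (x : R), derivable (derive1n n c) x 1.

Definition critical_set (R : realType) (c : R -> R) : set R :=
  [set x | derive1 c x = 0].

Definition TS_function (R : realType) (c : R -> R) : Prop :=
  smooth c /\
  exists P : set (set R),
    [/\ countable P, P `<=` @point_or_interval R &
        disjoint_union_of P id (critical_set c)].

Definition decomposed_over (R : realType) (J : Type) (A : set R) : Prop :=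
  exists I : J -> set R,
    disjoint_union_of [set: J] I A /\
    forall j, [/\ closed (I j), connected (I j), I j !=set0 &
                  point_or_interval (I j)].

(* The value of the function is the first coordinate.  *)
Definition graph_of (R : realType) (c : R -> R) : set (R * R) :=
  [set p | p.1 = c p.2].

Definition tangent_line (R : realType) (c : R -> R) (x : R) : set (R * R) :=
  [set p | exists t : R, p = (c x + t * derive1 c x, x + t)].

Definition rotation (R : realType) (theta : R) (p : R * R) : R * R :=
  (cos theta * p.1 - sin theta * p.2, sin theta * p.1 + cos theta * p.2).

Definition discrete_subset (T : topologicalType) (A : set T) : Prop :=
  A `<=` isolated A.

(* Main.v *)
Require Import Defs.
From HB Require Import structures.
From mathcomp Require Import all_boot all_order all_algebra.
From mathcomp Require Import all_classical all_reals all_analysis.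
From mathcomp Require Import ring lra.
Import Order.TTheory GRing.Theory Num.Theory.
Import numFieldNormedType.Exports.
Local Open Scope classical_set_scope.
Local Open Scope ring_scope.

(* Rotate by [atan a_c], so that the direction [(a_c, 1)] becomes vertical.
   With [k := cos (atan a_c)] the point [(c0 t, t)] goes to [(h t, phi t)], where
   [h t = k (c0 t - a_c t)] and [phi t = k (a_c c0 t + t)].  The bounds
   [c0' >= -1/a_M] and [a_c < a_M] keep [phi'] above a positive constant, so
   [phi] is a diffeomorphism of the line and the rotated graph is that of
   [c1 := h \o phi^-1].  Its critical set is the image by [phi] of the level set,
   and [c1 y = c0 (phi^-1 y) / k - a_c y] is a bounded function minus a linear
   one.  The critical values are, up to scaling, the intercepts
   [c0 x - a_c x] of the parallel tangent lines with the axis [p.2 = 0]; they form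
   a closed set because the union of the lines is closed, and a discrete one
   because each line is open in that union. *)

(** * Iterated differentiability and its closure properties *)

Lemma is_derive1_derive1 {R : realType} (f : R -> R) (x l : R) :
  is_derive x 1 f l -> derive1 f x = l.
Proof. by move=> df; rewrite derive1E; exact: (@derive_val _ _ _ _ _ _ _ df). Qed.

(** The recursion peels off the first derivative instead of the last one, so that an induction on
    [n] may replace [f] by an explicit formula for its derivative. *)
Fixpoint n_times_derivable {R : realType} (n : nat) (f : R -> R) : Prop :=
  if n is m.+1 then
    (forall x, derivable f x 1) /\ n_times_derivable m (derive1 f)
  else True.

Lemma smoothP {R : realType} (f : R -> R) :
  smooth f <-> forall n, n_times_derivable n f.
Proof.
split=> [sf n|nf n].
- elim: n f sf => // n IHn f sf; split=> [x|]; first exact: (sf 0%N).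
  by apply: IHn => k x; rewrite -derive1Sn; exact: sf.
- elim: n f nf => [|n IHn] f nf x; first by have [+ _] := nf 1%N; exact.
  by rewrite derive1Sn; apply: IHn => k; have [] := nf k.+1.
Qed.

Lemma n_times_derivableS {R : realType} (n : nat) (f g : R -> R) :
  (forall x : R, is_derive x 1 f (g x)) -> n_times_derivable n g ->
  n_times_derivable n.+1 f.
Proof.
move=> fg ng; split=> [x|]; first exact: (@ex_derive _ _ _ _ _ _ _ (fg x)).
by rewrite (_ : derive1 f = g) //; apply/funext => x; exact: is_derive1_derive1.
Qed.

Lemma n_times_derivable_pred {R : realType} (n : nat) (f : R -> R) :
  n_times_derivable n.+1 f -> n_times_derivable n f.
Proof.
by elim: n f => // n IHn f [df nf]; split=> //; exact: IHn.
Qed.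

Lemma derivable_is_derive1 {R : realType} (f : R -> R) (x : R) :
  derivable f x 1 -> is_derive x 1 f (derive1 f x).
Proof. by rewrite derive1E; exact: derivableP. Qed.

Lemma n_times_derivableD {R : realType} (n : nat) (f g : R -> R) :
  n_times_derivable n f -> n_times_derivable n g ->
  n_times_derivable n (fun x => f x + g x).
Proof.
elim: n f g => // n IHn f g [df nf] [dg ng].
apply: n_times_derivableS (IHn _ _ nf ng) => x.
by apply: is_deriveD; exact: derivable_is_derive1.
Qed.

(** Leibniz' rule: the derivative is a sum of products of one undifferentiated and one
    differentiated factor, all of them [n] times derivable, so the induction must range over all [f]
    and [g]. *)
Lemma n_times_derivableM {R : realType} (n : nat) (f g : R -> R) :
  n_times_derivable n f -> n_times_derivable n g ->
  n_times_derivable n (fun x => f x * g x).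
Proof.
elim: n f g => // n IHn f g nf ng.
have [df nf'] := nf; have [dg ng'] := ng.
have nfg := n_times_derivableD n _ _
  (IHn _ _ (n_times_derivable_pred _ _ nf) ng')
  (IHn _ _ (n_times_derivable_pred _ _ ng) nf').
apply: n_times_derivableS nfg => x.
by apply: is_deriveM; exact: derivable_is_derive1.
Qed.

Lemma n_times_derivable_cst {R : realType} (n : nat) (a : R) :
  n_times_derivable n (fun=> a).
Proof.
elim: n a => // n IHn a.
by apply: n_times_derivableS (IHn 0) => x; exact: is_derive_cst.
Qed.

Lemma n_times_derivable_id {R : realType} (n : nat) :
  n_times_derivable n (fun x : R => x).
Proof.
case: n => // n.
exact: n_times_derivableS (n_times_derivable_cst n 1).
Qed.

(** The derivative [- (1/f) * (1/f) * f'] involves only [f'] and [1/f] itself, which the induction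
    hypothesis covers one order lower. *)
Lemma n_times_derivableV {R : realType} (n : nat) (f : R -> R) :
  (forall x, f x != 0) -> n_times_derivable n f ->
  n_times_derivable n (fun x => (f x)^-1).
Proof.
move=> f0; elim: n => // n IHn nf; have [df nf'] := nf.
have nV := IHn (n_times_derivable_pred _ _ nf).
have nVV := n_times_derivableM _ _ _
  (n_times_derivableM _ _ _ (n_times_derivable_cst n (-1))
     (n_times_derivableM _ _ _ nV nV)) nf'.
apply: n_times_derivableS nVV => x.
have := is_deriveV (f0 x) (derivable_is_derive1 _ _ (df x)).
by rewrite /GRing.scale /= expr2 invfM mulN1r.
Qed.

(** * Diffeomorphisms of the line with derivative bounded below *)

Section Diffeomorphism.
Context {R : realType} (phi : R -> R) (m : R).
Hypotheses (phi_smooth : smooth phi) (m_gt0 : 0 < m).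
Hypothesis phi'_ge : forall x, m <= derive1 phi x.

Let phi_derive (x : R) : is_derive x 1 phi (derive1 phi x).
Proof. by apply: derivable_is_derive1; exact: (phi_smooth 0%N). Qed.

Let phi_continuous : continuous phi.
Proof.
by move=> x; apply/differentiable_continuous/derivable1_diffP/(phi_smooth 0%N).
Qed.

Lemma growth_ge (x y : R) : x <= y -> m * (y - x) <= phi y - phi x.
Proof.
move=> xy.
have [c _ ->] := @MVT_segment R phi (derive1 phi) x y xy
  (fun z _ => phi_derive z) (continuous_subspaceT phi_continuous).
by rewrite ler_wpM2r ?subr_ge0.
Qed.

Lemma increasing_diffeo_inverse :
  exists psi : R -> R, cancel phi psi /\ cancel psi phi.
Proof.
have surj y : exists x, phi x = y.
  (* Growing at rate at least [m] over a length [b], [phi] moves away from [phi 0] by at least the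
     distance to [y]; hence [y] lies between [phi (- b)] and [phi b]. *)
  pose b := `|y - phi 0| / m.
  have b0 : 0 <= b by rewrite divr_ge0 // ltW.
  have mb : m * b = `|y - phi 0| by rewrite mulrC divfK // gt_eqF.
  have hi := growth_ge 0 b b0.
  have lo : m * (0 - - b) <= phi 0 - phi (- b) by apply: growth_ge; lra.
  rewrite sub0r opprK mb in lo; rewrite subr0 mb in hi.
  have n1 := ler_norm (y - phi 0); have n2 := ler_norm (- (y - phi 0)).
  rewrite normrN in n2.
  have [| | |x _ <-] := @IVT R phi (- b) b y; last by exists x.
  - by lra.
  - exact: continuous_subspaceT.
  - by rewrite ge_min le_max; apply/andP; split; apply/orP; [left|right]; lra.
have inj : injective phi.
  move=> x y xy; apply/eqP; rewrite eq_le; apply/andP; split;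
    rewrite leNgt; apply/negP => lt_xy; have := growth_ge _ _ (ltW lt_xy);
    rewrite xy subrr pmulr_rle0 //; lra.
have [psi psiK] := choice surj.
by exists psi; split=> // x; apply: inj.
Qed.

Context (psi : R -> R) (phiK : cancel phi psi) (psiK : cancel psi phi).

Lemma inverse_is_derive (y : R) :
  is_derive y 1 psi (derive1 phi (psi y))^-1.
Proof.
have := @is_derive_inverse R phi psi (derive1 phi (psi y)) (psi y).
rewrite psiK; apply => //.
- by near=> z.
- by near=> z; exact: phi_continuous.
- by rewrite gt_eqF // (lt_le_trans m_gt0).
Unshelve. all: by end_near. Qed.

Lemma inverse_continuous : continuous psi.
Proof.
move=> y; apply/differentiable_continuous/derivable1_diffP.
exact: (@ex_derive _ _ _ _ _ _ _ (inverse_is_derive y)).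
Qed.

Lemma comp_inverse_is_derive (h : R -> R) (y : R) :
  derivable h (psi y) 1 ->
  is_derive y 1 (h \o psi) (derive1 h (psi y) / derive1 phi (psi y)).
Proof.
move=> /derivable_is_derive1 dh.
by apply: is_derive1_comp; exact: inverse_is_derive.
Qed.

(** The derivative of [h \o psi] is [(h' / phi') \o psi], again a smooth function composed with
    [psi]; the induction on the order therefore runs over all smooth [h] at once. *)
Lemma smooth_comp_inverse (h : R -> R) : smooth h -> smooth (h \o psi).
Proof.
rewrite !smoothP => nh n; elim: n h nh => // n IHn h nh.
pose h' x := derive1 h x / derive1 phi x.
apply: (@n_times_derivableS _ n _ (h' \o psi)) => [y|].
  by apply: comp_inverse_is_derive; have [+ _] := nh 1%N; exact.
apply: IHn => k; apply: n_times_derivableM; first by have [] := nh k.+1.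
apply: n_times_derivableV => [x|].
  by rewrite gt_eqF // (lt_le_trans m_gt0).
by have [] := (smoothP phi).1 phi_smooth k.+1.
Qed.

Lemma homeomorphic_sets_image (I B : set R) :
  homeomorphic_sets I B -> homeomorphic_sets (phi @` I) B.
Proof.
move=> [f [g [fI fK fc gc]]]; exists (f \o psi), (phi \o g); split.
- by rewrite -fI image_comp; apply: eq_imagel => x _ /=; rewrite phiK.
- by move=> _ /set_mem[x Ix <-] /=; rewrite phiK fK // mem_set.
- apply/subspace_continuousP => _ [x Ix <-] /=.
  apply: (@cvg_comp _ _ _ psi f _ (within I (nbhs x))).
    move=> U IU.
    have : \forall y \near phi x, I (psi y) -> U (psi y).
      have := inverse_continuous (phi x); rewrite /continuous_at phiK.
      by move/(_ [set z | I z -> U z] IU).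
    by apply: filterS => y IyU [z Iz zy]; apply: IyU; rewrite -zy phiK.
  rewrite /from_subspace /= phiK.
  by move/subspace_continuousP : fc; exact.
- by apply: (@within_continuous_comp _ _ _ B g phi) => // y _; exact: phi_continuous.
Qed.

Lemma point_or_interval_image (I : set R) :
  point_or_interval I -> point_or_interval (phi @` I).
Proof.
case=> [[x ->]|?|?|?]; last 3 first.
- by apply: Or42; exact: homeomorphic_sets_image.
- by apply: Or43; exact: homeomorphic_sets_image.
- by apply: Or44; exact: homeomorphic_sets_image.
by apply: Or41; exists (phi x); rewrite image_set1.
Qed.

(** The new pieces are the images of the old ones, indexed by themselves. Injectivity of [phi]
    forces two images that meet to come from the same index, and continuity of [psi] keeps each
    piece relatively open. *)
Lemma decomposed_over_image (J : Type) (A : set R) :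
  countable [set: J] -> decomposed_over J A ->
  exists P : set (set R),
    [/\ countable P, P `<=` @point_or_interval R &
        disjoint_union_of P id (phi @` A)].
Proof.
move=> Jc [K [[-> It Iopen] II]].
exists (range (fun j => phi @` K j)); split.
- exact: (card_le_trans (card_image_le _ _)).
- by move=> _ [j _ <-]; apply: point_or_interval_image; have [] := II j.
split.
- by rewrite bigcup_image image_bigcup.
- move=> _ _ [i _ <-] [j _ <-] [_ [[x Ix <-] [y Jy yx]]].
  have {}yx : y = x by rewrite -(phiK y) yx phiK.
  by rewrite (It i j) //; exists x; split=> //; rewrite -yx.
- move=> _ [j _ <-]; have [U Uo IU] := Iopen j I.
  exists (psi @^-1` U).
    by apply: open_comp => // y _; exact: inverse_continuous.
  rewrite IU; apply/seteqP; split=> [_ [x [Ax Ux] <-]|_ [[x Ax <-]]] /=.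
    by split; [exists x | rewrite phiK].
  by rewrite phiK => Ux; exists x.
Qed.
End Diffeomorphism.

(** * Closed discrete sets and affine images *)

Lemma discrete_subsetP {T : topologicalType} (A : set T) :
  discrete_subset A <->
  forall x, A x -> \forall y \near x, A y -> y = x.
Proof.
split=> dA x Ax.
- have [_ [V Vx VA]] := dA x Ax; apply: filterS Vx => y Vy Ay.
  by have : (V `&` A) y by []; rewrite VA.
- split; first exact: mem_set.
  exists [set y | A y -> y = x]; first exact: dA.
  by apply/seteqP; split=> [y [+ /[dup] Ay]|_ ->]; [exact|].
Qed.

(** Closedness prevents points of one set from accumulating at a point of the other: around any
    point of the space, a closed discrete set has at most that point itself. *)
Lemma discrete_subsetU {T : topologicalType} (A B : set T) :
  closed A -> closed B -> discrete_subset A -> discrete_subset B ->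
  discrete_subset (A `|` B).
Proof.
move=> Ac Bc /discrete_subsetP Ad /discrete_subsetP Bd.
have near_or (C : set T) : closed C ->
    (forall x, C x -> \forall y \near x, C y -> y = x) ->
    forall x, \forall y \near x, C y -> y = x.
  move=> Cc Cd x; have [/Cd//|nCx] := pselect (C x).
  have : \forall y \near x, (~` C) y.
    by apply: open_nbhs_nbhs; split=> //; exact: closed_openC.
  by apply: filterS => y nCy /nCy.
apply/discrete_subsetP => x _.
have := near_or _ Bc Bd x; apply: filterS2 (near_or _ Ac Ad x) => y Ay By.
by case=> [/Ay|/By].
Qed.

Section AffineImage.
Context {R : realType} (V : set R) (k b : R).
Hypothesis k_neq0 : k != 0.

Let affine_continuous (u v : R) : continuous (fun x : R => u * x + v).
Proof.
move=> x; apply: cvgD; last exact: cvg_cst.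
by apply: cvgM; [exact: cvg_cst | exact: cvg_id].
Qed.

(** Viewed as a preimage under the continuous inverse map, the image inherits closedness and
    discreteness directly. *)
Let affine_imageE :
  (fun v => k * v + b) @` V = (fun v => k^-1 * v + - (k^-1 * b)) @^-1` V.
Proof.
apply/seteqP; split=> [_ [v Vv <-]|v Vv] /=.
- by have -> : k^-1 * (k * v + b) + - (k^-1 * b) = v by field.
- by exists (k^-1 * v + - (k^-1 * b)) => //; field.
Qed.

Lemma closed_affine_image : closed V -> closed ((fun v => k * v + b) @` V).
Proof.
rewrite affine_imageE; apply: preimage_closed => x _; exact: affine_continuous.
Qed.

Lemma discrete_affine_image :
  discrete_subset V -> discrete_subset ((fun v => k * v + b) @` V).
Proof.
rewrite affine_imageE => /discrete_subsetP Vd; apply/discrete_subsetP => x /= Vx.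
pose g y := k^-1 * y + - (k^-1 * b).
have : \forall y \near x, V (g y) -> g y = g x.
  exact: (affine_continuous k^-1 (- (k^-1 * b)) x _ (Vd _ Vx)).
apply: filterS => y Vy /Vy /addIr; apply: mulfI.
by rewrite invr_eq0.
Qed.

End AffineImage.

(** * Parallel tangent lines and their intercepts *)

Section TangentLines.
Context {R : realType} (c : R -> R) (s : R).

Let level : set R := derive1 c @^-1` [set s].
Let tangents : set (R * R) := \bigcup_(x in level) tangent_line c x.
Let intercepts : set R := (fun x => c x - s * x) @` level.

(** All these lines have direction [(s, 1)], so each is a level set of the linear form
    [p.1 - s * p.2], and its level is its intercept with the axis [p.2 = 0]. *)
Let tangent_lineP (x : R) (p : R * R) :
  level x -> tangent_line c x p <-> p.1 - s * p.2 = c x - s * x.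
Proof.
rewrite /level /tangent_line /= => ->.
split=> [[t ->] /=|]; first by ring.
case: p => u v /= uv; exists (v - x).
by congr pair; [rewrite -[LHS](subrK (s * v)) uv|]; ring.
Qed.

Let interceptsE : intercepts = (fun v => (v, 0)) @^-1` tangents.
Proof.
apply/seteqP; split=> [_ [x Lx <-]|v [x Lx /(tangent_lineP _ _ Lx) /=]] /=.
- by exists x => //; apply/tangent_lineP => //=; rewrite mulr0 subr0.
- by rewrite mulr0 subr0 => ->; exists x.
Qed.

Let axis_continuous : continuous (fun v : R => (v, 0 : R)).
Proof.
move=> v U [[A B] [/= Av B0] AB].
suff : \forall w \near v, U (w, 0) by [].
apply: filterS Av => w Aw; apply: AB; split=> //=.
exact: nbhs_singleton B0.
Qed.

Lemma closed_intercepts : closed tangents -> closed intercepts.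
Proof.
rewrite interceptsE; apply: preimage_closed => x _; exact: axis_continuous.
Qed.

(** The piece through [(v, 0)] is one whole tangent line, which meets the axis only there; the open
    set of the plane that cuts it out of the union traces on the axis a neighbourhood isolating
    [v]. *)
Lemma discrete_intercepts (P : set (set (R * R))) :
  P `<=` tangent_line c @` level -> disjoint_union_of P id tangents ->
  discrete_subset intercepts.
Proof.
move=> Psub [tangentsE _ Popen]; apply/discrete_subsetP => v.
rewrite interceptsE => /= Tv.
have [F PF Fv] : (\bigcup_(F in P) F) (v, 0) by rewrite -tangentsE.
have [x Lx lineF] := Psub F PF; have [U Uo FU] := Popen F PF.
rewrite /= in FU Fv.
have Uv : U (v, 0) by move: Fv; rewrite FU => -[].
have : \forall w \near v, U (w, 0).
  exact: (axis_continuous v _ (open_nbhs_nbhs (conj Uo Uv))).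
apply: filterS => w Uw Tw.
have Fw : F (w, 0) by rewrite FU; split.
move: Fv Fw; rewrite -lineF => /(tangent_lineP _ _ Lx) + /(tangent_lineP _ _ Lx).
by rewrite /= mulr0 !subr0 => -> ->.
Qed.

End TangentLines.

(** * Limits at infinity and countable index types *)

Lemma bounded_sub_linear_cvg {R : realType} (f : R -> R) (s M : R) :
  0 < s -> (forall x, `|f x| <= M) ->
  f x - s * x @[x --> -oo] --> +oo /\ f x - s * x @[x --> +oo] --> -oo.
Proof.
move=> s0 fM; split.
- apply/cvgryPge => A.
  near=> x; have : x <= - ((A + M) / s) by near: x;
    exact: (nbhs_ninfty_le (num_real _)).
  rewrite -mulNr ler_pdivlMr // => xA.
  by have := fM x; rewrite ler_norml => /andP[? _]; lra.
- apply/cvgrNyPle => A.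
  near=> x; have : (M - A) / s <= x by near: x;
    exact: (nbhs_pinfty_ge (num_real _)).
  rewrite ler_pdivrMr // => xA.
  by have := fM x; rewrite ler_norml => /andP[_ ?]; lra.
Unshelve. all: by end_near. Qed.

(** The three shapes of index set are unified by countability, the property used when the pieces are
    transported by [phi]. *)
Lemma decomposed_overW {R : realType} (A : set R) :
  [\/ exists2 l : nat, (0 < l)%N & decomposed_over 'I_l A,
      decomposed_over nat A | decomposed_over int A] ->
  exists J : countType, decomposed_over J A.
Proof. by case=> [[l _]||]; eexists; eassumption. Qed.

(** * The rotated graph *)

Theorem theorem3 (R : realType) (c0 : R -> R) (a_m a_M a_c : R)
    (c0_TS : TS_function c0)
    (c0_bounded : bounded_fun c0)
    (a_m_gt0 : 0 < a_m) (a_M_gt0 : 0 < a_M) (a_m_lt_a_M : a_m < a_M)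
    (c0_slope : forall x : R, - (1 / a_M) <= derive1 c0 x /\ derive1 c0 x <= a_m)
    (a_c_gt0 : 0 < a_c) (a_c_lt_a_M : a_c < a_M)
    (level_neq0 : derive1 c0 @^-1` [set a_c] !=set0)
    (level_decomposed :
      [\/ exists2 l : nat, (0 < l)%N &
            decomposed_over 'I_l (derive1 c0 @^-1` [set a_c]),
          decomposed_over nat (derive1 c0 @^-1` [set a_c]) |
          decomposed_over int (derive1 c0 @^-1` [set a_c])])
    (tangents_disjoint :
      exists P : set (set (R * R)),
        [/\ countable P,
            P `<=` tangent_line c0 @` (derive1 c0 @^-1` [set a_c]) &
            disjoint_union_of P id
              (\bigcup_(x in derive1 c0 @^-1` [set a_c]) tangent_line c0 x)])
    (tangents_closed :
      closed (\bigcup_(x in derive1 c0 @^-1` [set a_c]) tangent_line c0 x)) :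
  exists (theta : R) (c1 : R -> R),
    rotation theta @` graph_of c0 = graph_of c1 /\
    forall a : R, 0 < a ->
    let c2 := fun x : R => c1 x + a in
    [/\ [/\ TS_function c1, TS_function c2, (forall x : R, c1 x < c2 x),
            discrete_subset
              (c1 @` critical_set c1 `|` c2 @` critical_set c2) &
            closed (c1 @` critical_set c1 `|` c2 @` critical_set c2)],
        critical_set c1 !=set0 /\ critical_set c2 !=set0,
        c1 x @[x --> -oo] --> +oo /\ c2 x @[x --> -oo] --> +oo &
        c1 x @[x --> +oo] --> -oo /\ c2 x @[x --> +oo] --> -oo].
Proof.
pose theta := atan a_c; pose k := cos theta.
have k_gt0 : 0 < k.
  by apply: cos_gt0_pihalf; rewrite atan_gtNpi2 atan_ltpi2.
have k_neq0 : k != 0 by rewrite gt_eqF.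
have sinE : sin theta = a_c * k.
  by rewrite -[in RHS](atanK a_c) /tan divfK.
(* Pythagoras, with the sine written as [a_c * k]; it later turns [1 / k] into a polynomial in [k]
   and [a_c]. *)
have kk : k * k * (1 + a_c * a_c) = 1.
  by rewrite -[RHS](cos2Dsin2 theta) sinE -/k; ring.
have c0_smooth : smooth c0 by have [] := c0_TS.
have c0_derive (x : R) : is_derive x 1 c0 (derive1 c0 x).
  by apply: derivable_is_derive1; exact: (c0_smooth 0%N).
have nc0 := (smoothP c0).1 c0_smooth.
pose phi t := k * (a_c * c0 t + t); pose h t := k * (c0 t + - a_c * t).
have phi_smooth : smooth phi.
  apply/smoothP => n.
  apply: n_times_derivableM (n_times_derivable_cst n k) _.
  apply: n_times_derivableD (n_times_derivable_id n).
  exact: n_times_derivableM (n_times_derivable_cst n a_c) (nc0 n).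
have h_smooth : smooth h.
  apply/smoothP => n.
  apply: n_times_derivableM (n_times_derivable_cst n k) _.
  apply: n_times_derivableD (nc0 n) _.
  exact: n_times_derivableM (n_times_derivable_cst n _) (n_times_derivable_id n).
have phi'E (x : R) : derive1 phi x = k * (a_c * derive1 c0 x + 1).
  exact: is_derive1_derive1.
have h'E (x : R) : derive1 h x = k * (derive1 c0 x + - a_c).
  rewrite -[in RHS](mulr1 (- a_c)); exact: is_derive1_derive1.
(* Inserting [c0' >= - 1 / a_M] into [phi' = k * (a_c * c0' + 1)] gives this bound, positive because
   [a_c < a_M]. *)
pose m := k * (1 - a_c / a_M).
have m_gt0 : 0 < m by rewrite mulr_gt0 // subr_gt0 ltr_pdivrMr // mul1r.
have phi'_ge (x : R) : m <= derive1 phi x.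
  rewrite phi'E ler_pM2l // addrC lerD2r.
  have [lo _] := c0_slope x.
  by have := ler_wpM2l (ltW a_c_gt0) lo; rewrite mulrN mul1r.
have phi'_neq0 (x : R) : derive1 phi x != 0.
  by rewrite gt_eqF // (lt_le_trans m_gt0).
have [psi [phiK psiK]] :=
  increasing_diffeo_inverse phi m phi_smooth m_gt0 phi'_ge.
pose c1 := h \o psi.
have c1_smooth : smooth c1.
  exact: (smooth_comp_inverse phi m phi_smooth m_gt0 phi'_ge psi phiK psiK).
have c1'E (y : R) : derive1 c1 y = derive1 h (psi y) / derive1 phi (psi y).
  apply: is_derive1_derive1.
  apply: (comp_inverse_is_derive phi m phi_smooth m_gt0 phi'_ge psi phiK psiK).
  exact: (h_smooth 0%N).
pose level := derive1 c0 @^-1` [set a_c].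
have critE : critical_set c1 = phi @` level.
  apply/seteqP; split=> [y|_ [x Lx <-]]; rewrite /critical_set /= c1'E.
  - move/eqP; rewrite mulf_eq0 invr_eq0 (negbTE (phi'_neq0 _)) orbF h'E.
    rewrite mulf_eq0 (negbTE k_neq0) subr_eq0 => /eqP Ly.
    by exists (psi y).
  - by rewrite phiK h'E Lx subrr mulr0 mul0r.
have smooth_shift a : smooth (fun x => c1 x + a).
  apply/smoothP => n; apply: n_times_derivableD (n_times_derivable_cst n a).
  exact: ((smoothP c1).1 c1_smooth n).
have crit_shift a : critical_set (fun x => c1 x + a) = critical_set c1.
  suff d1 (y : R) : derive1 (fun x => c1 x + a) y = derive1 c1 y.
    by apply/seteqP; split=> y; rewrite /critical_set /= d1.
  rewrite -[RHS]addr0; apply: is_derive1_derive1.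
  exact: (is_deriveD (derivable_is_derive1 _ _ (c1_smooth 0%N y))
    (is_derive_cst a y 1)).
have crit_pieces : exists P : set (set R),
    [/\ countable P, P `<=` @point_or_interval R &
        disjoint_union_of P id (critical_set c1)].
  rewrite critE; have [J] := decomposed_overW _ level_decomposed.
  by apply: decomposed_over_image (countableP _); eassumption.
(* At the critical point [phi x] the value of [c1] is [h x], that is, [k] times the intercept of the
   tangent line at [x]. *)
have valuesE a : (fun x => c1 x + a) @` critical_set c1 =
    (fun v => k * v + a) @` ((fun x => c0 x - a_c * x) @` level).
  rewrite critE !image_comp; apply: eq_imagel => x _ /=.
  by rewrite /c1 /= phiK /h mulNr.
have [P [_ Psub Pdisj]] := tangents_disjoint.
have Vclosed := closed_intercepts c0 a_c tangents_closed.
have Vdiscrete := discrete_intercepts c0 a_c P Psub Pdisj.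
(* Reading [c1] as its own shift by [0] lets [valuesE] and [limits] serve both [c1] and [c2]. *)
have c1E : c1 = fun x => c1 x + 0 by apply/funext => x; rewrite addr0.
(* Put [y = phi t] and [1 / k = k * (1 + a_c * a_c)]: the terms in [a_c * a_c * c0 t] cancel and
   [h t] remains. *)
have c1_linear y : c1 y = c0 (psi y) / k - a_c * y.
  have kV : k^-1 = k * (1 + a_c * a_c).
    by apply: (mulfI k_neq0); rewrite mulfV // mulrA kk.
  rewrite -[in a_c * y](psiK y) kV /c1 /h /phi /=; ring.
have [M c0M] : exists M, forall x, `|c0 x| <= M.
  have [M [_ c0M]] := pinfty_ex_gt (num_real 0) c0_bounded.
  by exists M => x; exact: c0M.
have limits a : c1 x + a @[x --> -oo] --> +oo /\ c1 x + a @[x --> +oo] --> -oo.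
  have -> : (fun x => c1 x + a) =
      (fun x => (c0 (psi x) / k + a) - a_c * x).
    by apply/funext => x; rewrite c1_linear addrAC.
  apply: (bounded_sub_linear_cvg _ a_c (M / k + `|a|)) => // x.
  rewrite (le_trans (ler_normD _ _)) // lerD2r normrM normfV (gtr0_norm k_gt0).
  by rewrite ler_pM2r ?invr_gt0.
exists theta, c1; split.
  rewrite /graph_of; apply/seteqP; split=> [_ [[u t] /= -> <-]|[u y] /= ->].
  - have -> : rotation theta (c0 t, t) = (h t, phi t).
      by rewrite /rotation /= -/k sinE /h /phi; congr pair; ring.
    by rewrite /= /c1 /= phiK.
  - exists (c0 (psi y), psi y) => //.
    rewrite /rotation /= -/k sinE -[in RHS](psiK y) /c1 /h /phi /=.
    by congr pair; rewrite ?phiK; ring.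
move=> a a_gt0 c2.
have V1 := valuesE 0; rewrite -c1E in V1; have V2 := valuesE a.
have [lim1Ny lim1y] := limits 0; have [lim2Ny lim2y] := limits a.
rewrite -c1E in lim1Ny lim1y.
split => //.
- rewrite (crit_shift a) V1 V2.
  split.
  + by split.
  + by split; [exact: smooth_shift | rewrite crit_shift].
  + by move=> x; rewrite ltrDl.
  + apply: discrete_subsetU; do ?exact: closed_affine_image;
      exact: discrete_affine_image.
  + by apply: closedU; exact: closed_affine_image.
- rewrite crit_shift critE; split; exact: image_nonempty.
Qed.
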